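(* Let $1<p<\infty$, let $b\in L^1_{\mathrm{loc}}(\mathbb{R})$, let $(u,v)$ be a pair of weights on $\mathbb{R}$, and let $H$ be the Hilbert transform on $\mathbb{R}$. If $\mathsf{C}$ is a constant such that $$\left(\int_{\mathbb{R}}|[b,H]f|^p u\,dx\right)^{1/p}\le\mathsf{C}\left(\int_{\mathbb{R}}|f|^p v\,dx\right)^{1/p}$$ for all $f$, then $$\sup_I\left(\frac1{v(I)}\int_I|b-b_I|^p u\,dx\right)^{1/p}\le\mathsf{C}\quad\text{and}\quad\sup_I\left(\frac1{u^{-p'/p}(I)}\int_I|b-b_I|^{p'}v^{-p'/p}\,dx\right)^{1/p'}\le\mathsf{C},$$ where the suprema are over all bounded intervals $I\subset\mathbb{R}$.
   Context: A weight is a nonnegative locally integrable function, positive a.e. $p'=p/(p-1)$; $w(I)=\int_I w\,dx$; $b_I=\frac1{|I|}\int_I b\,dx$. The Hilbert transform is $Hf(x)=\mathrm{p.v.}\int_{\mathbb{R}}\frac{f(y)}{x-y}\,dy$ (with no factor $1/\pi$), and $[b,H]f=b\,Hf-H(bf)$, i.e. $[b,H]f(x)=\mathrm{p.v.}\int_{\mathbb{R}}\frac{b(x)-b(y)}{x-y}f(y)\,dy$. The hypothesis ''for all $f$'' is understood for all bounded compactly supported $f$. An interval with $u^{-p'/p}(I)=\infty$ contributes $0$ to the second supremum. *)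

(* Defs.v *)
From HB Require Import structures.
From mathcomp Require Export all_boot all_order all_algebra.
From mathcomp Require Export all_classical all_reals all_analysis.
From mathcomp Require Export measurable_realfun.

Set Implicit Arguments.
Unset Strict Implicit.
Unset Printing Implicit Defensive.

Export Order.TTheory GRing.Theory Num.Theory.
Export numFieldNormedType.Exports.

Local Open Scope classical_set_scope.
Local Open Scope ring_scope.

Section defs.
Context {R : realType}.
Local Notation mu := (@lebesgue_measure R).
Implicit Types (b f g u v w : R -> R) (x p : R) (I : set R).

Definition weight w : Prop :=
  [/\ locally_integrable [set: R] w,
      forall x, 0 <= w x &
      {ae mu, forall x, 0 < w x}].

Definition wmeas w I : \bar R := (\int[mu]_(x in I) (w x)%:E)%E.

Definition conj_exp p : R := p / (p - 1).

(* The intervals over which averages make sense: bounded, of any shape at the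
   endpoints, and not reduced to at most one point. *)
Definition bounded_interval I : Prop :=
  [/\ is_interval I, bounded_set I & (0 < mu I)%E].

Definition avg b I : R := (fine (mu I))^-1 * \int[mu]_(x in I) b x.

Definition bounded_compactly_supported f : Prop :=
  [/\ measurable_fun [set: R] f, bounded_fun f &
      compact (closure [set x | f x != 0])].

Definition truncation g x (eps : R) : R :=
  \int[mu]_(y in [set y | eps < `|x - y|]) g y.

(* Principal value at x of the integral of g, as an extended real: the limit of
   the truncations when it exists, and +oo otherwise. For b locally integrable
   and f bounded with compact support, the principal values defining H f,
   H (b f) and [b, H] f exist at almost every x (classical), so the value +oo
   is taken on a null set only and does not affect the integrals below. *)
Definition pv g x : \bar R :=
  if `[< cvg (truncation g x eps @[eps --> 0^'+]) >]
  then (lim (truncation g x eps @[eps --> 0^'+]))%:E else +oo%E.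

Definition hilbert f x : \bar R := pv (fun y => f y / (x - y)) x.

Definition hilbert_commutator b f x : \bar R :=
  pv (fun y => (b x - b y) / (x - y) * f y) x.

Definition wnorm p w (g : R -> \bar R) : \bar R :=
  ((\int[mu]_x ((`|g x| `^ p) * (w x)%:E)) `^ p^-1)%E.

(* ((1 / s(I)) \int_I |b - b_I|^p w)^(1/p).  In \bar R, +oo^-1 = 0 and
   0 * +oo = 0, so this is 0 when s(I) = +oo. *)
Definition oscillation p w s b I : \bar R :=
  (((wmeas s I)^-1 *
    \int[mu]_(x in I) (`|b x - avg b I| `^ p * w x)%:E) `^ p^-1)%E.

Lemma pv_fin_num g x : pv g x \is a fin_num ->
  truncation g x eps @[eps --> 0^'+] --> fine (pv g x).
Proof. by rewrite /pv; case: asboolP => // cg _. Qed.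

Lemma pv_cvg g x (l : R) : truncation g x eps @[eps --> 0^'+] --> l ->
  pv g x = l%:E.
Proof.
move=> gl; rewrite /pv; case: asboolP => [_|[]]; last by apply/cvg_ex; exists l.
by congr EFin; apply: cvg_lim.
Qed.

Lemma measurable_far x (eps : R) : measurable [set y : R | eps < `|x - y|].
Proof.
rewrite (_ : mkset _ = [set: R] `&` (fun y => `|x - y|) @^-1` `]eps, +oo[%classic);
  last by apply/seteqP; split => y /=; rewrite in_itv/= andbT; tauto.
have mf : measurable_fun [set: R] (fun y => `|x - y|).
  by apply: measurableT_comp => //; exact: measurable_funD.
exact: mf.
Qed.

Lemma integrable_truncation (g : R -> R) x (eps : R) : 0 < eps ->
  mu.-integrable [set: R] (EFin \o g) ->
  mu.-integrable [set y | eps < `|x - y|] (EFin \o (fun y => g y / (x - y))).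
Proof.
move=> eps0 ig.
have mD : measurable ([set y | eps < `|x - y|] : set (measurableTypeR R)) := measurable_far x eps.
have igD : mu.-integrable [set y | eps < `|x - y|] (EFin \o g).
  by apply: integrableS ig => //; exact: subsetT.
have mg : measurable_fun [set y | eps < `|x - y|] g.
  by apply/measurable_EFinP; exact: (measurable_int mu).
have iE : mu.-integrable [set y | eps < `|x - y|]
    (fun y => ((eps^-1)%:E * (EFin \o g) y)%E) by exact: integrableZl.
apply: le_integrable iE => //.
  apply/measurable_EFinP; apply: measurable_funM => //.
  apply: subspace_continuous_measurable_fun => //.
  apply: continuous_in_subspaceT => y; rewrite inE/= => yD.
  apply: cvgV; last by apply: cvgB; [exact: cvg_cst|exact: cvg_id].
  by apply: contraTneq yD => ->; rewrite normr0 -leNgt ltW.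
move=> y /= yD; rewrite lee_fin !normrM mulrC ler_wpM2r//.
have d0 : 0 < `|x - y| by exact: lt_trans eps0 yD.
by rewrite normfV (gtr0_norm (_ : 0 < eps^-1)) ?invr_gt0// lef_pV2 ?posrE// ltW.
Qed.

Lemma integrable_bcs b f : locally_integrable [set: R] b ->
  bounded_compactly_supported f ->
  mu.-integrable [set: R] (EFin \o (fun y => b y * f y)).
Proof.
move=> [mb _ ib] [mf [M [_ fM]] cf].
set K := closure _ in cf.
have mK : measurable K by apply: closed_measurable; exact: closed_closure.
have f0 y : ~ K y -> f y = 0.
  by move=> nK; apply: contrapT => /eqP fy; apply: nK; apply: subset_closure.
have {}fM y : `|f y| <= `|M| + 1.
  by apply: (fM (`|M| + 1)) => //; rewrite (le_lt_trans (ler_norm M))// ltrDl.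
apply/integrableP; split.
  by apply/measurable_EFinP; exact: measurable_funM.
have mbK : measurable_fun K (fun y => (`|b y|%:E)%E).
  apply/measurable_EFinP; apply: measurableT_comp => //; exact: measurable_funTS.
apply: (@le_lt_trans _ _ (\int[mu]_(y in K) ((`|M| + 1)%:E * (`|b y|)%:E))%E).
  rewrite [leRHS]integral_mkcond; apply: ge0_le_integral => //.
  - by apply: measurableT_comp => //; apply/measurable_EFinP; exact: measurable_funM.
  - by apply/(measurable_restrictT _ _).1 => //; exact: emeasurable_funM.
  - move=> y _; rewrite /patch /=; case: ifPn => [_|/negP yK].
      by rewrite -EFinM lee_fin normrM mulrC ler_wpM2r.
    by rewrite f0 ?mulr0 ?normr0// => yK'; apply: yK; rewrite inE.
rewrite ge0_integralZl//.
by rewrite lte_mul_pinfty ?lee_fin ?addr_ge0//; exact: ib.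
Qed.

(* [b, H] f = b H f - H (b f) wherever the right-hand side is defined. *)
Lemma hilbert_commutatorE b f x : locally_integrable [set: R] b ->
  bounded_compactly_supported f ->
  hilbert f x \is a fin_num -> hilbert (b \* f) x \is a fin_num ->
  hilbert_commutator b f x =
  ((b x)%:E * hilbert f x - hilbert (b \* f)%R x)%E.
Proof.
move=> lb hf fx bfx.
have [l1 E1] : exists l, hilbert f x = l%:E by exists (fine (hilbert f x)); rewrite fineK.
have [l2 E2] : exists l, hilbert (b \* f) x = l%:E.
  by exists (fine (hilbert (b \* f) x)); rewrite fineK.
move: (pv_fin_num fx) (pv_fin_num bfx).
rewrite -/(hilbert f x) -/(hilbert (b \* f) x) E1 E2 /= => c1 c2.
rewrite -EFinM -EFinB; apply: pv_cvg.
have c3 := cvgB (cvgM (cvg_cst (b x)) c1) c2.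
apply: (cvg_trans _ (c3 _ _ _)); apply: near_eq_cvg; near=> eps.
have eps0 : 0 < eps by near: eps; exact: nbhs_right_gt.
have i2 := integrable_truncation x eps0 (integrable_bcs lb hf).
have l1' : locally_integrable [set: R] (cst 1 : R -> R).
  split; [exact: measurable_cst|exact: openT|move=> K _ cK].
  have mK : measurable K.
    by apply: closed_measurable; apply: compact_closed => //; exact: norm_hausdorff.
  rewrite (eq_integral (cst 1%E)); last by move=> y _; rewrite /= normr1.
  by rewrite integral_cst// mul1e; exact: compact_finite_measure.
have i1 : mu.-integrable [set y | eps < `|x - y|] (EFin \o (fun y => f y / (x - y))).
  apply: integrable_truncation => //.
  apply: eq_integrable (integrable_bcs l1' hf) => //.
  by move=> y _ /=; rewrite mul1r.
have mD : measurable ([set y | eps < `|x - y|] : set (measurableTypeR R)) := measurable_far x eps.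
have e1 : b x * truncation (fun y => f y / (x - y)) x eps =
    \int[mu]_(y in [set y | eps < `|x - y|]) (b x * (f y / (x - y))).
  exact/esym/RintegralZl.
have i3 : mu.-integrable [set y | eps < `|x - y|]
    (EFin \o (fun y => b x * (f y / (x - y)))).
  by apply: eq_integrable (integrableZl mD (b x) i1) => // y _.
transitivity (b x * truncation (fun y => f y / (x - y)) x eps -
    truncation (fun y => b y * f y / (x - y)) x eps) => //.
rewrite e1 /truncation -RintegralB//.
apply: eq_Rintegral => y _ /=.
by rewrite -!mulrA [_^-1 * _]mulrC mulrBl.
Unshelve. all: by end_near. Qed.

End defs.

(* Main.v *)
(* For an interval I of length L centred at m and h supported in I, write
   x - y = (x - m) - (y - m).  Then, with T = [b, H],
     \int_I (b x - b y) h y dy = (x - m) T h x - T ((. - m) h) x,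
   and |x - m|, |y - m| <= L / 2 on I, so that the left-hand side has L^p(u, I)
   norm at most C L |h|_{L^p(v)}.  For h = 1_I the left-hand side is
   L (b x - b_I), which is the first bound.  Integrating it over I gives
   - L \int (b - b_I) h, so Hoelder's inequality bounds this pairing by
   C L u^{-p'/p}(I)^{1/p'} |h|_{L^p(v)}; the second bound follows by taking
   for h truncations of the extremal function
   sgn(b - b_I) |b - b_I|^{p'-1} v^{-p'/p} 1_I.
   No existence theorem for principal values is needed: T f is replaced from
   below by the measurable limsup of its truncations along eps = 1/(n+1). *)
Require Import Defs.
From mathcomp Require Import ring lra.

Set Implicit Arguments.
Unset Strict Implicit.
Unset Printing Implicit Defensive.

Local Open Scope classical_set_scope.
Local Open Scope ring_scope.

Section commutator.
Context {R : realType}.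
Local Notation mu := (@lebesgue_measure R).
Implicit Types (b g h k u v w s : R -> R) (p C : R) (I E : set R).

(** * Integrals without measurability, measurability of truncations, test functions *)

(** A nonnegative integral is a supremum over the simple functions below the integrand, and there
    are more of these when the integrand grows. This is applied to [hilbert_commutator b f], whose
    measurability is never established. *)
Lemma ge0_le_integral_nonmeasurable d (T : measurableType d)
    (m : {measure set T -> \bar R}) (f g : T -> \bar R) :
  (forall x, (0 <= f x)%E) -> (forall x, (f x <= g x)%E) ->
  (\int[m]_x f x <= \int[m]_x g x)%E.
Proof.
move=> f0 fg; rewrite !ge0_integralTE//; last by move=> x; exact: le_trans (fg x).
apply: le_ereal_sup => _ [h /= hf <-]; exists h => //= x.
exact: le_trans (fg x).
Qed.

Lemma measurable_inv : measurable_fun [set: R] (fun x : R => x^-1).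
Proof.
(* The square makes the base of the power nonnegative; at [0] both sides vanish since [0^-1 = 0]. *)
rewrite (_ : (fun x : R => x^-1) = (fun x => x * (x * x) `^ (-1))); last first.
  apply/funext => x; rewrite -expr2 powR_inv1 ?sqr_ge0//.
  have [->|x0] := eqVneq x 0; first by rewrite invr0 mul0r.
  by rewrite expr2 invfM mulrA mulfV// mul1r.
have msq : measurable_fun [set: R] (fun x : R => x * x) by exact: measurable_funM.
apply: measurable_funM => //.
exact: (@measurableT_comp _ _ _ _ _ _ (@powR R ^~ (-1))).
Qed.

(** By Tonelli, the integrals in [y] of the positive and negative parts of the kernel cut off to [D]
    are measurable in [x]; the truncation is [fine] of their difference. *)
Lemma measurable_truncation (K : R -> R -> R) (eps : R) :
  measurable_fun [set: R * R] (fun z => K z.1 z.2) ->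
  measurable_fun [set: R] (fun x => truncation (K x) x eps).
Proof.
move=> mK.
pose D : set (R * R) := [set z | eps < `|z.1 - z.2|].
have mD : measurable D.
  rewrite (_ : D = [set: R * R] `&` (fun z => `|z.1 - z.2|) @^-1` `]eps, +oo[%classic);
    last by apply/seteqP; split => y /=; rewrite in_itv/= andbT /D/=; tauto.
  have mf : measurable_fun [set: R * R] (fun z : R * R => `|z.1 - z.2|).
    by apply: measurableT_comp => //; exact: measurable_funB.
  exact: mf.
pose G := (EFin \o (fun z => K z.1 z.2)) \_ D.
have mG : measurable_fun [set: R * R] G.
  by apply/(measurable_restrictT _ _).1 => //; apply/measurable_funTS/measurable_EFinP.
have mF : measurable_fun [set: R]
    (fun x => fubini_F mu (fun z => G^\+ z) x - fubini_F mu (fun z => G^\- z) x)%E.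
  apply: emeasurable_funB => //; apply: measurable_fun_fubini_tonelli_F => //.
    exact: measurable_funepos.
  exact: measurable_funeneg.
rewrite (_ : (fun x => _) = fine \o
   (fun x => fubini_F mu (fun z => G^\+ z) x - fubini_F mu (fun z => G^\- z) x)%E).
  exact: (measurableT_comp (@fine_measurable R setT measurableT) mF).
apply/funext => x; rewrite /truncation /Rintegral integral_mkcond integralE /=.
by congr (fine (_ - _)%E); apply: eq_integral => y _;
  rewrite ?funeposE ?funenegE /G /patch !mem_setE.
Qed.

Lemma bounded_compactly_supported_itv g (M c d : R) :
  measurable_fun [set: R] g -> (forall x, `|g x| <= M) ->
  (forall x, x \notin `[c, d] -> g x = 0) -> bounded_compactly_supported g.
Proof.
move=> mg gM g0; split => //.
  exists M; split; first exact: num_real.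
  by move=> N MN x _ /=; rewrite (le_trans (gM x))// ltW.
apply: (subclosed_compact _ (@segment_compact _ c d)); first exact: closed_closure.
have /closure_id -> : closed `[c, d] by exact: itv_closed.
apply: closure_subset => x /= gx; apply: contrapT => /negP/g0 E.
by rewrite E eqxx in gx.
Qed.

Lemma integrable_bounded_compactly_supported h : bounded_compactly_supported h ->
  mu.-integrable [set: R] (EFin \o h).
Proof.
move=> hh; apply: eq_integrable (integrable_bcs
  (locally_integrable_indic (@openT R) (@measurableT _ R)) hh) => // y _ /=.
by rewrite indicE in_setT mul1r.
Qed.

Lemma integrable_commutator_kernel b h (x : R) : locally_integrable [set: R] b ->
  bounded_compactly_supported h ->
  mu.-integrable [set: R] (EFin \o (fun y => (b x - b y) * h y)).
Proof.
move=> lb hh.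
have i1 := integrable_bounded_compactly_supported hh.
have i2 := integrable_bcs lb hh.
apply: eq_integrable (integrableB measurableT (integrableZl measurableT (b x) i1) i2) => //.
by move=> y _ /=; rewrite -EFinM -EFinB mulrBl.
Qed.

(** * The limsup of truncations as a substitute for the principal value *)

Lemma le_esups (u : (\bar R)^nat) n : (u n <= esups u n)%E.
Proof. by apply: ereal_sup_ubound; exists n => /=. Qed.

Definition truncation_limsup (k : R -> R) x : \bar R :=
  limn_esup (fun n => `|truncation k x n.+1%:R^-1|%:E).

Lemma truncation_limsup_ge0 k x : (0 <= truncation_limsup k x)%E.
Proof.
rewrite /truncation_limsup limn_esup_lim; apply: lime_ge; first exact: is_cvg_esups.
by apply: nearW => n; apply: le_trans (le_esups _ n); rewrite lee_fin.
Qed.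

(** Where the principal value exists, the truncations at [n.+1%:R^-1] converge to it and equality
    holds; elsewhere [pv] is [+oo] by convention. *)
Lemma truncation_limsup_le_pv k x : (truncation_limsup k x <= `|pv k x|)%E.
Proof.
rewrite /pv; case: asboolP => [/cvg_ex[l kl]|_]; last by rewrite leey.
have -> : lim (truncation k x eps @[eps --> 0^'+]) = l by exact: cvg_lim.
rewrite /truncation_limsup; suff -> : limn_esup
    (fun n => `|truncation k x n.+1%:R^-1|%:E) = `|l%:E|%E by [].
apply: (cvg_limn_einf_sup _).2; apply: cvg_EFin; first exact: nearW.
apply: cvg_norm.
apply: (cvg_at_rightP _ _ _).1 kl _ _; split; last exact: cvg_harmonic.
by move=> n; rewrite invr_gt0.
Qed.

(** Dominated convergence with majorant [|k|]. A point [y != x] enters [D n] once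
    [n.+1%:R^-1 < |x - y|]; the point [x] stays outside every [D n], and there [k x = 0] settles the
    convergence. *)
Lemma truncation_cvg_integral k (x : R) : mu.-integrable [set: R] (EFin \o k) -> k x = 0 ->
  truncation k x n.+1%:R^-1 @[n --> \oo] --> \int[mu]_y k y.
Proof.
move=> ik kx.
pose D n : set R := [set y | n.+1%:R^-1 < `|x - y|].
have mD n : measurable (D n) by exact: measurable_far.
have mk : measurable_fun [set: R] (EFin \o k) by exact: measurable_int ik.
apply: fine_cvg; rewrite fineK; last exact: integrable_fin_num.
rewrite (_ : (fun n => _) = fun n => (\int[mu]_y ((EFin \o k) \_ (D n)) y)%E); last first.
  by apply/funext => n; rewrite -integral_mkcond.
apply: (@dominated_cvg _ _ _ mu _ measurableT _ _ (abse \o (EFin \o k))) => //.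
- move=> n; apply/(measurable_restrictT _ _).1; first exact: mD.
  by apply: measurable_funS mk.
- move=> y _.
  have [->|xy] := eqVneq y x.
    rewrite /patch /= kx; apply: cvg_near_cst; apply: nearW => n.
    by case: ifP.
  apply: cvg_near_cst; near=> n.
  rewrite /patch ifT// inE /D/=.
  near: n; apply: (@cvgr_lt _ _ _ _ _ _ (@cvg_harmonic R)).
  by rewrite normr_gt0 subr_eq0 eq_sym.
- exact: integrable_abse.
- move=> n y _; rewrite /patch; case: ifP => // _.
  by rewrite (_ : point = 0%E)// abse0 abse_ge0.
Unshelve. all: by end_near. Qed.

(** * Cancelling the singularity of the commutator kernel *)

Definition commutator_kernel b x h y := (b x - b y) / (x - y) * h y.

(** The factor [(x - c) - (y - c) = x - y] cancels the denominator. With [eps > 0] the truncated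
    kernels are integrable and [x - y] is nonzero on the domain. *)
Lemma commutator_truncation_split b h x c (eps : R) : 0 < eps ->
  locally_integrable [set: R] b ->
  bounded_compactly_supported h ->
  bounded_compactly_supported (fun y => (y - c) * h y) ->
  truncation (fun y => (b x - b y) * h y) x eps =
  (x - c) * truncation (commutator_kernel b x h) x eps -
  truncation (commutator_kernel b x (fun y => (y - c) * h y)) x eps.
Proof.
move=> eps0 lb hh hch; rewrite /truncation.
have mD : measurable ([set y | eps < `|x - y|] : set (measurableTypeR R)) := measurable_far x eps.
have ik g : bounded_compactly_supported g ->
    mu.-integrable [set y | eps < `|x - y|] (EFin \o commutator_kernel b x g).
  move=> hg; have i0 := integrable_truncation x eps0 (integrable_commutator_kernel x lb hg).
  apply: eq_integrable i0 => // y _ /=.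
  by rewrite /commutator_kernel mulrAC.
have ik1 : mu.-integrable [set y | eps < `|x - y|]
    (EFin \o (fun y => (x - c) * commutator_kernel b x h y)).
  exact: eq_integrable (integrableZl mD (x - c) (ik _ hh)).
rewrite -RintegralZl ?ik// -RintegralB// ?ik//.
apply: eq_Rintegral => y; rewrite inE/= => yD.
have xy : x - y != 0 by rewrite -normr_gt0 (lt_trans eps0).
rewrite /commutator_kernel.
rewrite [RHS](_ : _ = (b x - b y) * h y * ((x - y) / (x - y))); last by ring.
by rewrite divff// mulr1.
Qed.

(** Limit of the splitting along [eps = 1/(n+1)]: the left-hand truncations have no singularity and
    converge to the full integral, while those on the right are dominated by their suprema over
    tails, which always converge. *)
Lemma integral_commutator_kernel_le b h x (c r : R) :
  locally_integrable [set: R] b ->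
  bounded_compactly_supported h ->
  bounded_compactly_supported (fun y => (y - c) * h y) -> `|x - c| <= r ->
  (`|\int[mu]_y ((b x - b y) * h y)|%:E <=
    r%:E * truncation_limsup (commutator_kernel b x h) x +
    truncation_limsup (commutator_kernel b x (fun y => (y - c) * h y)%R) x)%E.
Proof.
move=> lb hh hch xcr.
have r0 : 0 <= r by exact: le_trans xcr.
set h' := fun y => (y - c) * h y.
pose s g n := `|truncation (commutator_kernel b x g) x n.+1%:R^-1|%:E.
have cs g : esups (s g) n @[n --> \oo] --> truncation_limsup (commutator_kernel b x g) x.
  by rewrite /truncation_limsup limn_esup_lim; exact: is_cvg_esups.
have cl : (`|truncation (fun y => (b x - b y) * h y) x n.+1%:R^-1|%:E)
    @[n --> \oo] --> (`|\int[mu]_y ((b x - b y) * h y)|%:E).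
  apply: cvg_EFin; first exact: nearW.
  apply: cvg_norm; apply: truncation_cvg_integral; last by rewrite subrr mul0r.
  exact: integrable_commutator_kernel.
have cr : (r%:E * esups (s h) n + esups (s h') n)%E @[n --> \oo] -->
    (r%:E * truncation_limsup (commutator_kernel b x h) x +
     truncation_limsup (commutator_kernel b x h') x)%E.
  apply: cvgeD; last exact: cs; last by apply: cvgeZl => //; exact: cs.
  by apply: ge0_adde_def; rewrite inE ?mule_ge0 ?truncation_limsup_ge0.
apply: lee_cvg_to cl cr _; apply: nearW => n.
have n0 : (0 : R) < n.+1%:R^-1 by rewrite invr_gt0.
rewrite (commutator_truncation_split x n0 lb hh hch).
apply: le_trans (leeD (lee_wpmul2l _ (le_esups (s h) n)) (le_esups (s h') n)) => //.
rewrite /s -EFinM -EFinD lee_fin (le_trans (ler_normB _ _))// lerD2r normrM.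
by rewrite ler_wpM2r.
Qed.

(** * Weighted estimates in the form of [p]-th powers *)

Definition commutator_bounded p b u v C := forall f, bounded_compactly_supported f ->
  (wnorm p u (hilbert_commutator b f) <= C%:E * wnorm p v (EFin \o f))%E.

(** The [p]-th power of [wnorm]: without the outer root, the two pieces of the splitting can be
    added under one integral. *)
Definition wmass p w g : \bar R := (\int[mu]_x (`|g x| `^ p * w x)%:E)%E.

Lemma wmass_ge0 p w g : (forall x, 0 <= w x) -> (0 <= wmass p w g)%E.
Proof.
by move=> w0; apply: integral_ge0 => x _; rewrite lee_fin mulr_ge0 ?powR_ge0.
Qed.

Lemma poweR_le_of_root p (X Y : \bar R) C : 0 < p -> 0 <= C ->
  (0 <= X)%E -> (0 <= Y)%E -> (X `^ p^-1 <= C%:E * Y `^ p^-1)%E ->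
  (X <= (C `^ p)%:E * Y)%E.
Proof.
move=> p0 C0 X0 Y0 XY.
have pV Z : (0 <= Z)%E -> ((Z `^ p^-1) `^ p)%E = Z.
  by move=> Z0; rewrite -poweRrM mulVf ?gt_eqF// poweRe1.
rewrite -[X in (X <= _)%E]pV// -[Y in (_ * Y)%E]pV// -poweR_EFin -poweRM ?poweR_ge0//.
by apply: gt0_ler_poweR XY; rewrite ?(ltW p0)// in_itv/= leey andbT ?mule_ge0 ?poweR_ge0 ?lee_fin.
Qed.

(** The hypothesis on the commutator, raised to the power [p] and carried over to the limsup of
    truncations, which lies below [|pv|] pointwise. *)
Lemma truncation_limsup_wmass p b u v C f : 0 < p -> 0 <= C ->
  (forall x, 0 <= u x) -> (forall x, 0 <= v x) ->
  commutator_bounded p b u v C -> bounded_compactly_supported f ->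
  (\int[mu]_x ((truncation_limsup (commutator_kernel b x f) x) `^ p * (u x)%:E) <=
    (C `^ p)%:E * wmass p v f)%E.
Proof.
move=> p0 C0 u0 v0 H hf.
have pow_u x (X : \bar R) : (0 <= X `^ p * (u x)%:E)%E.
  by rewrite mule_ge0 ?poweR_ge0 ?lee_fin.
apply: (@le_trans _ _ (\int[mu]_x (`|hilbert_commutator b f x| `^ p * (u x)%:E))%E).
  apply: ge0_le_integral_nonmeasurable => // x.
  rewrite lee_wpmul2r ?lee_fin//; apply: gt0_ler_poweR; first exact: ltW.
  - by rewrite in_itv/= leey andbT truncation_limsup_ge0.
  - by rewrite in_itv/= leey andbT.
  - exact: (truncation_limsup_le_pv (commutator_kernel b x f) x).
apply: poweR_le_of_root => //.
- exact: integral_ge0.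
- exact: wmass_ge0.
- exact: H.
Qed.

Lemma ge0_integral_lincomb (f g : R -> \bar R) (k r : \bar R) :
  measurable_fun [set: R] f -> measurable_fun [set: R] g ->
  (forall x, 0 <= f x)%E -> (forall x, 0 <= g x)%E -> (0 <= k)%E -> (0 <= r)%E ->
  (\int[mu]_x (k * (r * f x + g x)) =
   k * (r * \int[mu]_x f x + \int[mu]_x g x))%E.
Proof.
move=> mf mg f0 g0 k0 r0.
have mrf : measurable_fun [set: R] (fun x => r * f x)%E by exact: measurable_funeM.
have rf0 x : (0 <= r * f x)%E by exact: mule_ge0.
rewrite ge0_integralZl//; last by move=> x _; exact: adde_ge0.
  by rewrite ge0_integralD// ge0_integralZl.
exact: emeasurable_funD.
Qed.

(** Convexity of [t^p] at the midpoint of [x] and [y], multiplied by [2^p]. *)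
Lemma powR_midpoint_convex p (x y : R) : 1 <= p -> 0 <= x -> 0 <= y ->
  (x + y) `^ p <= 2 `^ (p - 1) * (x `^ p + y `^ p).
Proof.
move=> p1 x0 y0.
have H : (2^-1 * x + 2^-1 * y) `^ p <= 2^-1 * x `^ p + 2^-1 * y `^ p.
  rewrite {2 4}(_ : 2^-1 = 1 - 2^-1); last by rewrite {2}(splitr 1) div1r addrK.
  by apply: (convex_powR p1 (Itv01 _ _)) => //=;
    rewrite ?inE/= ?in_itv/= ?x0 ?y0// ?invr_ge0// invf_le1 ?ler1n.
rewrite (_ : x + y = 2 * (2^-1 * x + 2^-1 * y)); last by field.
rewrite powRM// ?addr_ge0 ?mulr_ge0 ?invr_ge0//.
rewrite (le_trans (ler_wpM2l (powR_ge0 _ _) H))// -mulrDr mulrA ler_wpM2r//.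
  by rewrite addr_ge0 ?powR_ge0.
by rewrite powRB ?powRr1// pnatr_eq0 implybT.
Qed.

Lemma poweR_midpoint_convex p (a : R) (X Y : \bar R) : 1 <= p -> 0 <= a ->
  (0 <= X)%E -> (0 <= Y)%E -> (a%:E <= X + Y)%E ->
  ((a `^ p)%:E <= (2 `^ (p - 1))%:E * (X `^ p + Y `^ p))%E.
Proof.
move=> p1 a0; have p0 : 0 < p by lra.
have c0 : 0 < 2 `^ (p - 1) :> R by rewrite powR_gt0.
case: X => [x| |]//; case: Y => [y| |]// x0 y0 axy; last 3 first.
- by rewrite poweR_EFin poweRyr ?gt_eqF// addey// gt0_muley ?leey.
- by rewrite poweR_EFin poweRyr ?gt_eqF// addye// gt0_muley ?leey.
- by rewrite poweRyr ?gt_eqF// addye// gt0_muley ?leey.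
rewrite !poweR_EFin -EFinD -EFinM lee_fin.
apply: le_trans (powR_midpoint_convex p1 _ _) => //.
by rewrite ge0_ler_powR ?nnegrE ?addr_ge0// ltW.
Qed.

(* The constant does not degrade because both pieces of
   [|I| (b - b_I) = (x - c) T h - T ((y - c) h)] obey the same bound, with
   factor [|I| / 2], so that convexity at the midpoint replaces Minkowski. *)
Lemma oscillation_integral_bound p b u v C (c d M : R) h :
  1 < p -> 0 <= C -> locally_integrable [set: R] b ->
  measurable_fun [set: R] u -> (forall x, 0 <= u x) ->
  measurable_fun [set: R] v -> (forall x, 0 <= v x) ->
  commutator_bounded p b u v C -> c <= d ->
  measurable_fun [set: R] h -> (forall x, `|h x| <= M) ->
  (forall x, x \notin `[c, d] -> h x = 0) ->
  (\int[mu]_(x in `[c, d])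
     (`|(\int[mu]_y ((b x - b y) * h y))%R| `^ p * u x)%:E <=
   ((C * (d - c)) `^ p)%:E * wmass p v h)%E.
Proof.
move=> p1 C0 lb mu_ u0 mv v0 H cd mh hM h0.
have p0 : 0 < p by lra.
have mb : measurable_fun [set: R] b by case: lb.
(* Midpoint and half-length: on [[c, d]] the factors [x - m] and [y - m] are both at most [r] in
   absolute value. *)
pose m := (c + d) / 2; pose r := (d - c) / 2.
have r0 : 0 <= r by rewrite /r; lra.
have mr x : x \in `[c, d] -> `|x - m| <= r.
  by rewrite in_itv/= => /andP[? ?]; rewrite ler_norml /m /r; lra.
set h' := fun y => (y - m) * h y.
have mh' : measurable_fun [set: R] h'.
  by apply: measurable_funM => //; exact: measurable_funB.
have h'r x : `|h' x| <= r * `|h x|.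
  have [xI|xI] := boolP (x \in `[c, d]); last by rewrite /h' h0// mulr0 normr0 mulr0.
  by rewrite normrM ler_wpM2r// mr.
have hh : bounded_compactly_supported h by exact: bounded_compactly_supported_itv hM h0.
have hh' : bounded_compactly_supported h'.
  apply: (@bounded_compactly_supported_itv _ (r * M) c d) => // x.
    by rewrite (le_trans (h'r x))// ler_wpM2l.
  by move=> xI; rewrite /h' h0 ?mulr0.
pose G g x := truncation_limsup (commutator_kernel b x g) x.
have mG g : measurable_fun [set: R] g -> measurable_fun [set: R] (G g).
  move=> mg; apply: measurable_fun_limn_esup => n.
  apply/measurable_EFinP; apply: measurableT_comp => //.
  apply: measurable_truncation.
  apply: measurable_funM; last exact: measurableT_comp.
  apply: measurable_funM; first by apply: measurable_funB; exact: measurableT_comp.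
  by apply: (measurableT_comp measurable_inv); exact: measurable_funB.
have G0 g x : (0 <= G g x)%E by exact: truncation_limsup_ge0.
pose P g x := ((G g x) `^ p * (u x)%:E)%E.
have mP g : measurable_fun [set: R] g -> measurable_fun [set: R] (P g).
  move=> mg; apply: emeasurable_funM; last exact/measurable_EFinP.
  by apply: (measurableT_comp (measurable_poweR p)); exact: mG.
have P0 g x : (0 <= P g x)%E by rewrite mule_ge0 ?poweR_ge0 ?lee_fin.
set k := 2 `^ (p - 1); have k0 : 0 <= k by exact: powR_ge0.
have rp0 : (0 <= (r `^ p)%:E)%E by rewrite lee_fin powR_ge0.
have P0' x : (0 <= (r `^ p)%:E * P h x + P h' x)%E.
  by apply: adde_ge0 => //; exact: mule_ge0.
(* The pointwise bound holds on [[c, d]]; elsewhere the left-hand integrand is cut off to [0], so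
   the right-hand side may be integrated over the whole line. *)
apply: (@le_trans _ _ (\int[mu]_x (k%:E * ((r `^ p)%:E * P h x + P h' x)))%E).
  rewrite integral_mkcond; apply: ge0_le_integral_nonmeasurable => x.
    by apply: erestrict_ge0 => y _; rewrite lee_fin mulr_ge0 ?powR_ge0.
  rewrite /patch; case: ifPn => [xI|_]; last first.
    by apply: mule_ge0; rewrite ?lee_fin.
  rewrite EFinM.
  have := integral_commutator_kernel_le lb hh hh' (mr x _).
  rewrite -/(G h x) -/(G h' x) => /(_ ltac:(by move: xI; rewrite inE)) Hx.
  have := poweR_midpoint_convex (ltW p1) (normr_ge0 _) _ (G0 h' x) Hx.
  rewrite -/k => /(_ ltac:(by rewrite mule_ge0)) {}Hx.
  apply: le_trans (lee_wpmul2r _ Hx) _; first by rewrite lee_fin.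
  rewrite -muleA lee_wpmul2l ?lee_fin// ge0_muleDl ?poweR_ge0// poweRM//.
  by rewrite poweR_EFin muleA.
have mPh := mP _ mh; have mPh' := mP _ mh'.
rewrite (ge0_integral_lincomb mPh mPh')//.
have Bh := truncation_limsup_wmass p0 C0 u0 v0 H hh.
have Bh' := truncation_limsup_wmass p0 C0 u0 v0 H hh'.
have Wh' : (wmass p v h' <= (r `^ p)%:E * wmass p v h)%E.
  rewrite /wmass -ge0_integralZl//; last 2 first.
  - apply/measurable_EFinP; apply: measurable_funM => //.
    apply: (measurableT_comp (measurable_powR p)).
    exact: measurableT_comp.
  - by move=> x _; rewrite lee_fin mulr_ge0 ?powR_ge0.
  apply: ge0_le_integral_nonmeasurable => x; first by rewrite lee_fin mulr_ge0 ?powR_ge0.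
  rewrite -EFinM lee_fin mulrA ler_wpM2r// -powRM//.
  by rewrite ge0_ler_powR ?nnegrE ?(mulr_ge0 r0)// ltW.
have W0 : (0 <= wmass p v h)%E by exact: wmass_ge0.
have Cp0 : (0 <= (C `^ p)%:E)%E by rewrite lee_fin powR_ge0.
(* Both terms carry the same factor [r^p]: the first explicitly, the second through
   [|h'| <= r |h|]. *)
have step : ((r `^ p)%:E * \int[mu]_x P h x + \int[mu]_x P h' x <=
    (2 * (C `^ p * r `^ p))%:E * wmass p v h)%E.
  rewrite mulr_natl mulr2n EFinD ge0_muleDl ?lee_fin ?mulr_ge0 ?powR_ge0//.
  apply: leeD.
    rewrite mulrC EFinM -muleA; exact: lee_wpmul2l Bh.
  rewrite EFinM -muleA; apply: le_trans Bh' _; exact: lee_wpmul2l Wh'.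
apply: le_trans (lee_wpmul2l _ step) _; first by rewrite lee_fin.
rewrite muleA -EFinM le_eqVlt; apply/orP; left; apply/eqP; congr (_%:E * _)%E.
(* The constants combine exactly: [2^(p-1) * 2 * (C r)^p = (2 C r)^p], and [2 r = d - c]. *)
rewrite (_ : C * (d - c) = 2 * (C * r)); last by rewrite /r; field.
rewrite powRM ?(mulr_ge0 C0)// (powRM _ C0 r0).
by rewrite /k powRB ?pnatr_eq0 ?implybT// powRr1//; field.
Qed.

(** * Intervals, Hoelder's inequality and conjugate exponents *)

(** The endpoints come from [Rhull I]: finite measure rules out infinite ones, positive measure
    rules out equal ones. *)
Lemma bounded_interval_itv I : bounded_interval I -> exists c d,
  [/\ c < d, measurable I, (forall x, I x -> x \in `[c, d]) & mu I = (d - c)%:E].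
Proof.
move=> [intI [M [_ bM]] I0].
have Ioo : (mu I < +oo)%E.
  have IM : I `<=` `[- (`|M| + 1), `|M| + 1].
    move=> x Ix /=; rewrite in_itv/= -ler_norml.
    by apply: (bM (`|M| + 1)) => //; rewrite (le_lt_trans (ler_norm M))// ltrDl.
  apply: (@le_lt_trans _ _ (mu `[- (`|M| + 1), `|M| + 1])).
    by apply: le_measure => //; rewrite inE; [exact: is_interval_measurable|exact: measurable_itv].
  by rewrite lebesgue_measure_itv/=; case: ifPn => // _; rewrite -EFinB ltry.
have mI := is_interval_measurable intI.
move: Ioo I0 mI; move/is_intervalP : intI => ->.
case: (Rhull I) => [[b1 c|[]] [b2 d|[]]]; rewrite lebesgue_measure_itv/= ?ltxx//;
  case: ifPn => // cd; rewrite ?ltxx// => _ _ mI.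
exists c, d; split => //.
  by move=> x /=; rewrite !in_itv/= => /andP[/lteifW -> /lteifW ->].
Qed.

(** Hoelder's inequality for [g u^(1/p)] and [u^(-1/p)] on [D]; with [q] the conjugate exponent,
    [(u^(-1/p))^q = u^(-q/p)]. *)
Lemma weighted_hoelder p u g (D : set R) : 1 < p -> measurable D ->
  measurable_fun [set: R] g -> measurable_fun [set: R] u ->
  (forall x, 0 <= u x) -> {ae mu, forall x, 0 < u x} ->
  (\int[mu]_(x in D) `|g x|%:E <=
   (\int[mu]_(x in D) (`|g x| `^ p * u x)%:E) `^ p^-1 *
   wmeas (fun x => (u x `^ (- (conj_exp p / p)))%R) D `^ (conj_exp p)^-1)%E.
Proof.
move=> p1 mD mg mu_ u0 upos.
set q := conj_exp p.
have p0 : 0 < p by lra.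
have q0 : 0 < q by rewrite divr_gt0// subr_gt0.
have pq : p^-1 + q^-1 = 1 by rewrite /q /conj_exp; field; lra.
pose f1 x := g x * u x `^ p^-1 * \1_D x.
pose f2 x := u x `^ (- p^-1) * \1_D x.
have mpow r : measurable_fun [set: R] (fun x => u x `^ r).
  exact: (measurableT_comp (measurable_powR r)).
have m1 : measurable_fun [set: R] (\1_D : R -> R) by exact: measurable_indic.
have mf1 : measurable_fun [set: R] f1.
  by apply: measurable_funM => //; exact: measurable_funM.
have mf2 : measurable_fun [set: R] f2 by exact: measurable_funM.
have := @hoelder _ _ _ mu f1 f2 p q mf1 mf2 p0 q0 pq.
rewrite Lnorm1 unlock.
have restrictE (F : R -> \bar R) (G : R -> R) :
    (forall x, x \in D -> F x = (G x)%:E) -> (forall x, x \notin D -> F x = 0%E) ->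
    (\int[mu]_x F x = \int[mu]_(x in D) (G x)%:E)%E.
  move=> FG F0; rewrite [RHS]integral_mkcond; apply: eq_integral => x _.
  by rewrite /patch; case: ifPn => [/FG|/F0].
rewrite (restrictE (fun x => `|(EFin \o f1) x| `^ p)%E (fun x => `|g x| `^ p * u x)); last 2 first.
- move=> x xD; rewrite /= /f1 indicE xD mulr1 normrM (ger0_norm (powR_ge0 _ _)).
  by rewrite powRM ?powR_ge0// -powRrM mulVf ?gt_eqF// powRr1.
- move=> x xD; rewrite /= /f1 indicE (negbTE xD) mulr0 normr0.
  by rewrite powR0// gt_eqF.
rewrite (restrictE (fun x => `|(EFin \o f2) x| `^ q)%E (fun x => u x `^ (- (q / p)))); last 2 first.
- move=> x xD; rewrite /= /f2 indicE xD mulr1 (ger0_norm (powR_ge0 _ _)).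
  by rewrite -powRrM; congr (_ `^ _)%:E; rewrite mulNr mulrC.
- move=> x xD; rewrite /= /f2 indicE (negbTE xD) mulr0 normr0.
  by rewrite powR0// gt_eqF.
apply: le_trans; rewrite le_eqVlt; apply/orP; left; apply/eqP.
(* The two factors multiply to [g] on [D] where [u > 0], which is almost everywhere. *)
rewrite [LHS]integral_mkcond; apply: ge0_ae_eq_integral => //.
- apply/(measurable_restrictT _ _).1 => //; apply/measurable_funTS/measurable_EFinP.
  exact: measurableT_comp.
- apply/measurableT_comp => //; apply/measurable_EFinP; exact: measurable_funM.
- by move=> x _; apply: erestrict_ge0 => y _; rewrite lee_fin.
- apply: (@filterS _ _ (ae_filter_ringOfSetsType mu) _ _ _ upos) => x ux _.
  rewrite /patch /= /f1 /f2.
  rewrite indicE; case: ifPn => xD; last by rewrite !mulr0 normr0.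
  rewrite !mulr1 -mulrA -powRD ?subrr ?powRr0 ?mulr1//.
  by rewrite (gt_eqF ux) implybT.
Qed.

Lemma conj_exp_gt1 p : 1 < p -> 1 < conj_exp p.
Proof. by move=> p1; rewrite /conj_exp ltr_pdivlMr ?subr_gt0// mul1r; lra. Qed.

Lemma conj_exp_inv p : 1 < p -> p^-1 + (conj_exp p)^-1 = 1.
Proof. by move=> p1; rewrite /conj_exp; field; lra. Qed.

Lemma conj_exp_div p : 1 < p -> conj_exp p / p = conj_exp p - 1.
Proof. by move=> p1; rewrite /conj_exp; field; lra. Qed.

Lemma commutator_integralE b h x : locally_integrable [set: R] b ->
  bounded_compactly_supported h ->
  \int[mu]_y ((b x - b y) * h y) = b x * \int[mu]_y h y - \int[mu]_y (b y * h y).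
Proof.
move=> lb hh.
have i1 := integrable_bounded_compactly_supported hh.
have i2 := integrable_bcs lb hh.
rewrite -RintegralZl// -RintegralB//; last first.
  by apply: eq_integrable (integrableZl measurableT (b x) i1) => // y _ /=.
by apply: eq_Rintegral => y _; rewrite mulrBl.
Qed.

Lemma bounded_compactly_supported_indic I (c d : R) : measurable I ->
  (forall x, I x -> x \in `[c, d]) -> bounded_compactly_supported (\1_I : R -> R).
Proof.
move=> mI Icd; apply: (@bounded_compactly_supported_itv _ 1 c d) => //.
  by move=> x; rewrite indicE; case: (x \in I); rewrite ?normr1 ?normr0.
move=> x xI; rewrite indicE memNset// => /Icd.
by apply/negP.
Qed.

Lemma integrable_on_interval b I (c d : R) : locally_integrable [set: R] b ->
  measurable I -> (forall x, I x -> x \in `[c, d]) ->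
  mu.-integrable I (EFin \o b).
Proof.
move=> lb mI Icd.
have ib := integrable_bcs lb (bounded_compactly_supported_indic mI Icd).
have ibI : mu.-integrable I (EFin \o (fun y => b y * \1_I y)).
  exact: integrableS ib.
apply: eq_integrable ibI => // y yI /=.
by rewrite indicE yI mulr1.
Qed.

(** Clears the quotient and the root, with degenerate masses treated apart: an infinite mass has
    inverse [0], and a zero mass forces the integral to be [0] by hypothesis. *)
Lemma oscillation_le p w s b I C : 0 < p -> 0 <= C -> (forall x, 0 <= w x) ->
  (forall x, 0 <= s x) ->
  ((wmeas s I < +oo)%E -> (\int[mu]_(x in I) (`|b x - avg b I| `^ p * w x)%:E <=
    (C `^ p)%:E * wmeas s I)%E) ->
  (oscillation p w s b I <= C%:E)%E.
Proof.
move=> p0 C0 w0 s0; rewrite /oscillation.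
set X := (\int[mu]_(x in I) _)%E.
have X0 : (0 <= X)%E by apply: integral_ge0 => x _; rewrite lee_fin mulr_ge0 ?powR_ge0.
have Y0 : (0 <= wmeas s I)%E by apply: integral_ge0 => x _; rewrite lee_fin.
case: (wmeas s I) Y0 => [y| |]// Y0 => [/(_ (ltry _)) XY|_]; last first.
  by rewrite invey mul0e poweR0r ?invr_neq0 ?gt_eqF.
suff H : (y%:E^-1 * X <= (C `^ p)%:E)%E.
  have -> : C%:E = ((C `^ p)%:E `^ p^-1)%E.
    by rewrite poweR_EFin -powRrM mulfV ?gt_eqF// powRr1.
  apply: gt0_ler_poweR H; rewrite ?invr_ge0 ?(ltW p0)//.
    by rewrite in_itv/= leey andbT mule_ge0// inve_ge0.
  by rewrite in_itv/= leey andbT lee_fin powR_ge0.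
move: XY; rewrite -EFinM; case: X X0 => [x| |]// x0; rewrite lee_fin => xy.
have [y0|y0] := eqVneq y 0.
  have -> : x = 0 by apply: le_anti; move: xy; rewrite y0 mulr0 => ->.
  by rewrite mule0 lee_fin powR_ge0.
rewrite inver (negbTE y0) -EFinM lee_fin mulrC ler_pdivrMr//.
by rewrite lt_neqAle eq_sym y0.
Qed.

(** * The two test functions on a fixed interval *)

Section fixed_interval.
Context (p : R) (b u v : R -> R) (C c d : R) (I : set R).
Context (p1 : 1 < p) (C0 : 0 <= C) (lb : locally_integrable [set: R] b)
  (wu : weight u) (wv : weight v) (bound : commutator_bounded p b u v C)
  (cd : c < d) (mI : measurable I) (Icd : forall x, I x -> x \in `[c, d])
  (muI : mu I = (d - c)%:E).

Let mu_ : measurable_fun [set: R] u. Proof. by case: wu => -[]. Qed.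
Let mv : measurable_fun [set: R] v. Proof. by case: wv => -[]. Qed.
Let u0 x : 0 <= u x. Proof. by case: wu. Qed.
Let v0 x : 0 <= v x. Proof. by case: wv. Qed.
Let p0 : 0 < p. Proof. exact: lt_trans p1. Qed.
Let dc0 : 0 < d - c. Proof. by rewrite subr_gt0. Qed.
Let ibI : mu.-integrable I (EFin \o b).
Proof. exact: integrable_on_interval Icd. Qed.

Lemma integral_avg : \int[mu]_(x in I) b x = (d - c) * avg b I.
Proof. by rewrite /avg muI /= mulrA divff ?mul1r// gt_eqF. Qed.

(** Restricts the bound on [[c, d]] to [I] and expands the inner integral, which is affine in [b x].
    Both test functions, the indicator and the extremal one, enter here. *)
Lemma interval_commutator_bound h (M : R) : measurable_fun [set: R] h ->
  (forall x, `|h x| <= M) -> (forall x, ~ I x -> h x = 0) ->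
  (\int[mu]_(x in I)
     (`|(b x * \int[mu]_y h y - \int[mu]_y (b y * h y))%R| `^ p * u x)%:E <=
   ((C * (d - c)) `^ p)%:E * wmass p v h)%E.
Proof.
move=> mh hM h0.
have h0' x : x \notin `[c, d] -> h x = 0.
  by move=> xI; apply: h0 => /Icd; exact/negP.
have hh : bounded_compactly_supported h by exact: bounded_compactly_supported_itv hM h0'.
have := oscillation_integral_bound p1 C0 lb mu_ u0 mv v0 bound (ltW cd) mh hM h0'.
apply: le_trans.
under [X in (_ <= X)%E]eq_integral do rewrite commutator_integralE//.
apply: ge0_subset_integral => //.
- apply/measurable_funTS/measurable_EFinP; apply: measurable_funM => //.
  apply: (measurableT_comp (measurable_powR p)); apply: measurableT_comp => //.
  apply: measurable_funB => //; apply: measurable_funM => //; by case: lb.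
- by move=> x _; rewrite lee_fin mulr_ge0 ?powR_ge0.
Qed.

(** For the test function [\1_I] the inner integral is [(d - c) (b x - b_I)] and the mass is [v(I)];
    the factor [(d - c)^p] cancels. *)
Lemma oscillation_bound : (oscillation p u v b I <= C%:E)%E.
Proof.
apply: oscillation_le => // _.
have ind1 x : `|\1_I x| <= 1 :> R.
  by rewrite indicE; case: (x \in I); rewrite ?normr1 ?normr0.
have ind0 x : ~ I x -> \1_I x = 0 :> R by move=> xI; rewrite indicE memNset.
have := interval_commutator_bound (measurable_indic mI) ind1 ind0.
have intI : \int[mu]_y \1_I y = d - c :> R.
  by rewrite /Rintegral integral_indic// setIT; exact: (congr1 fine muI).
have intbI : \int[mu]_y (b y * \1_I y) = (d - c) * avg b I.
  rewrite -integral_avg [RHS]Rintegral_mkcond; apply: eq_Rintegral => y _.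
  by rewrite indicE /patch; case: (y \in I); rewrite ?mulr1 ?mulr0.
have massI : wmass p v \1_I = wmeas v I.
  rewrite /wmass /wmeas [RHS]integral_mkcond; apply: eq_integral => y _.
  rewrite indicE /patch; case: (y \in I); rewrite ?normr1 ?powR1 ?mul1r//.
  by rewrite normr0 powR0 ?mul0r// gt_eqF.
rewrite intI intbI massI.
have mX : measurable_fun I (fun x => (`|b x - avg b I| `^ p * u x)%:E).
  apply/measurable_funTS/measurable_EFinP; apply: measurable_funM => //.
  apply: (measurableT_comp (measurable_powR p)); apply: measurableT_comp => //.
  by apply: measurable_funB => //; case: lb.
have -> : (\int[mu]_(x in I) (`|(b x * (d - c) - (d - c) * avg b I)%R| `^ p * u x)%:E =
    ((d - c) `^ p)%:E * \int[mu]_(x in I) (`|(b x - avg b I)%R| `^ p * u x)%:E)%E.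
  rewrite -ge0_integralZl ?lee_fin ?powR_ge0//; last first.
    by move=> x _; rewrite lee_fin mulr_ge0 ?powR_ge0.
  apply: eq_integral => x _; rewrite -EFinM [in RHS]mulrA -powRM ?(ltW dc0)//.
  rewrite -{3}(gtr0_norm dc0) -normrM; congr (`|_| `^ _ * _)%:E; ring.
by rewrite powRM ?(ltW dc0)// mulrC EFinM -muleA lee_pmul2l// lte_fin powR_gt0.
Qed.

Local Notation q := (conj_exp p).
Let q0 : 0 < q. Proof. exact: lt_trans (conj_exp_gt1 p1). Qed.
Let w x := b x - avg b I.
Let u' x := u x `^ (- (q / p)).
Let v' x := v x `^ (- (q / p)).
Let mw : measurable_fun [set: R] w.
Proof. by apply: measurable_funB => //; case: lb. Qed.
Let mv' : measurable_fun [set: R] v'.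
Proof. exact: (measurableT_comp (measurable_powR _)). Qed.

(* The extremal function of the duality [L^p(v) - L^q(v^(-q/p))], cut off to a
   set [E] on which it is bounded, makes both [\int w h] and [\int |h|^p v]
   equal to [\int_E |w|^q v^(-q/p)]. *)
Lemma oscillation_dual_truncated E (N : R) : measurable E -> E `<=` I -> 0 < N ->
  (forall x, E x -> `|w x| <= N) -> (forall x, E x -> N^-1 <= v x) ->
  (wmeas u' I < +oo)%E ->
  (\int[mu]_(x in E) (`|w x| `^ q * v' x)%:E <=
   (C `^ q)%:E * wmeas u' I)%E.
Proof.
move=> mE EI N0 wN vN Yoo.
have q1 := conj_exp_gt1 p1.
have pq := conj_exp_inv p1.
have qp := conj_exp_div p1.
pose F x := `|w x| `^ q * v' x.
(* The signed power [sgn(t) |t|^(q-1)]; it vanishes at [0] even for [q < 2] because of the factor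
   [t]. *)
pose sgpow (t : R) := t * `|t| `^ (q - 2).
have norm_sgpow t : `|sgpow t| = `|t| `^ (q - 1).
  have [->|t0] := eqVneq t 0.
    by rewrite /sgpow mul0r normr0 powR0// gt_eqF// subr_gt0.
  rewrite /sgpow normrM (ger0_norm (powR_ge0 _ _)).
  rewrite (_ : q - 1 = 1 + (q - 2)); last by ring.
  by rewrite (@powRD _ _ 1) ?normr_eq0 ?t0 ?implybT// powRr1.
have mul_sgpow t : t * sgpow t = `|t| `^ q.
  have [->|t0] := eqVneq t 0.
    by rewrite mul0r normr0 powR0// gt_eqF.
  rewrite /sgpow mulrA -expr2 -real_normK ?num_real//.
  rewrite [in RHS](_ : q = 2%:R + (q - 2)); last by ring.
  by rewrite (@powRD _ _ 2%:R) ?normr_eq0 ?t0 ?implybT// powR_mulrn.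
(* The lower bound on [v] over [E] bounds its negative power [v'] from above; with [|w| <= N] this
   makes [h] an admissible test function. *)
have v'N x : E x -> v' x <= (N^-1 `^ (q / p))^-1.
  move=> Ex; have vx := vN x Ex.
  have Nv0 : 0 < N^-1 by rewrite invr_gt0.
  rewrite /v' powRN lef_pV2 ?posrE ?powR_gt0//; last exact: lt_le_trans vx.
  by rewrite ge0_ler_powR ?nnegrE ?(ltW Nv0) ?(ltW (divr_gt0 q0 p0)).
have v'0 x : 0 <= v' x by exact: powR_ge0.
pose h x := sgpow (w x) * v' x * \1_E x.
have mh : measurable_fun [set: R] h.
  apply: measurable_funM; last exact: measurable_indic.
  apply: measurable_funM => //; apply: measurable_funM => //.
  by apply: (measurableT_comp (measurable_powR _)); exact: measurableT_comp.
have hM x : `|h x| <= N `^ (q - 1) * (N^-1 `^ (q / p))^-1.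
  rewrite /h indicE; case: (boolP (x \in E)) => [|_]; last first.
    by rewrite mulr0 normr0 mulr_ge0 ?invr_ge0 ?powR_ge0.
  rewrite inE mulr1 => Ex.
  rewrite normrM norm_sgpow (ger0_norm (v'0 _)) ler_pM ?powR_ge0//; last exact: v'N.
  by rewrite ge0_ler_powR ?nnegrE ?subr_ge0 ?(ltW q1) ?(ltW N0) ?wN.
have hI x : ~ I x -> h x = 0.
  by move=> xI; rewrite /h indicE memNset ?mulr0// => /EI.
have hh : bounded_compactly_supported h.
  apply: (@bounded_compactly_supported_itv _ _ c d mh hM) => x xI; apply: hI => /Icd.
  exact/negP.
have F0 x : 0 <= F x by rewrite mulr_ge0 ?powR_ge0.
have mF : measurable_fun [set: R] F.
  apply: measurable_funM => //.
  by apply: (measurableT_comp (measurable_powR _)); exact: measurableT_comp.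
have wh x : w x * h x = (F \_ E) x.
  rewrite /h indicE /patch; case: (x \in E); last by rewrite !mulr0.
  by rewrite mulr1 mulrA mul_sgpow.
(* The exponents match because [p (q - 1) = q] and [v^(-q) v = v^(1-q) = v^(-q/p)]. *)
have hpv : wmass p v h = (\int[mu]_(x in E) (F x)%:E)%E.
  rewrite /wmass [RHS]integral_mkcond; apply: eq_integral => x _.
  rewrite /h indicE /patch; case: (boolP (x \in E)) => [|_]; last first.
    by rewrite mulr0 normr0 powR0 ?mul0r// gt_eqF.
  rewrite inE mulr1 => Ex.
  have vx : 0 < v x by apply: lt_le_trans (vN x Ex); rewrite invr_gt0.
  rewrite normrM norm_sgpow (ger0_norm (v'0 _)) powRM ?powR_ge0// -powRrM.
  congr EFin; rewrite -mulrA; congr (_ `^ _ * _).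
    by rewrite -qp divfK// gt_eqF.
  rewrite /v' -powRrM mulNr divfK ?gt_eqF//.
  rewrite -{2}(powRr1 (ltW vx)) -powRD ?(gt_eqF vx) ?implybT//.
  by congr (_ `^ _); rewrite qp; ring.
set A := (\int[mu]_(x in E) (F x)%:E)%E in hpv *.
(* Finiteness of [A] allows the later division by [a^(1/p)]. *)
have Aoo : (A < +oo)%E.
  apply: (@le_lt_trans _ _
    (\int[mu]_(x in E) (N `^ q * (N^-1 `^ (q / p))^-1)%:E)%E).
    apply: ge0_le_integral => //.
    - by move=> x _; rewrite lee_fin.
    - exact/measurable_funTS/measurable_EFinP.
    move=> x Ex; rewrite lee_fin ler_pM ?powR_ge0//; last exact: v'N.
    by rewrite ge0_ler_powR ?nnegrE ?(ltW q0) ?(ltW N0) ?wN.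
  rewrite integral_cst// lte_mul_pinfty ?lee_fin ?mulr_ge0 ?invr_ge0 ?powR_ge0//.
  apply: (@le_lt_trans _ _ (mu I)); last by rewrite muI ltry.
  by apply: le_measure => //; rewrite inE.
have A0 : (0 <= A)%E by apply: integral_ge0 => x _; rewrite lee_fin.
have [a Aa] : exists a, A = a%:E by exists (fine A); rewrite fineK// ge0_fin_numE.
have a0 : 0 <= a by rewrite -lee_fin -Aa.
have ih := integrable_bounded_compactly_supported hh.
have ibh := integrable_bcs lb hh.
set H := \int[mu]_y h y; set B := \int[mu]_y (b y * h y).
have whE : B - avg b I * H = a.
  rewrite /B /H -RintegralZl// -RintegralB//; last first.
    by apply: eq_integrable (integrableZl measurableT (avg b I) ih).
  transitivity (\int[mu]_(x in E) F x); last by rewrite /Rintegral -/A Aa.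
  rewrite [RHS]Rintegral_mkcond; apply: eq_Rintegral => x _.
  by rewrite -wh /w mulrBl.
have mIR : measurable (I : set (measurableTypeR R)) := mI.
pose D x := b x * H - B.
have mD : measurable_fun [set: R] D.
  by apply: measurable_funB => //; apply: measurable_funM => //; case: lb.
have i1 : mu.-integrable I (EFin \o (fun x => b x * H)).
  apply: eq_integrable (integrableZl mIR H ibI) => // x _ /=.
  by rewrite -EFinM mulrC.
have i2 : mu.-integrable I (EFin \o (cst B)).
  have i1I := integrable_on_interval
    (locally_integrable_indic (@openT R) (@measurableT _ R)) mI Icd.
  apply: eq_integrable (integrableZl mIR B i1I) => // x _ /=.
  by rewrite indicE in_setT mule1.
have iD : mu.-integrable I (EFin \o D).
  by apply: eq_integrable (integrableB mIR i1 i2).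
(* Integrating [b x * H - B] over [I] gives [(d - c) (b_I H - B)], that is, [-(d - c)] times the
   pairing of [w] with [h]. *)
have intD : \int[mu]_(x in I) D x = - ((d - c) * a).
  rewrite /D RintegralB// RintegralZr// Rintegral_cst// integral_avg -whE.
  have -> : fine (mu I) = d - c by rewrite muI.
  by ring.
set Y := wmeas _ I in Yoo *.
have Y0 : (0 <= Y)%E by apply: integral_ge0 => x _; rewrite lee_fin powR_ge0.
have [y Yy] : exists y, Y = y%:E by exists (fine Y); rewrite fineK// ge0_fin_numE.
have y0 : 0 <= y by rewrite -lee_fin -Yy.
have hoelder_D := weighted_hoelder p1 mI mD mu_ u0 (let: And3 _ _ upos := wu in upos).
have bound_D := interval_commutator_bound mh hM hI.
rewrite hpv Aa -EFinM in bound_D.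
have : ((d - c) * a <= (((C * (d - c)) `^ p * a) `^ p^-1) * y `^ q^-1)%R.
  rewrite -lee_fin.
  apply: (@le_trans _ _ (\int[mu]_(x in I) `|D x|%:E)%E).
    have -> : (d - c) * a = `|\int[mu]_(x in I) D x|.
      by rewrite intD normrN ger0_norm// mulr_ge0// ltW.
    rewrite EFin_normr_Rintegral//.
    apply: le_trans (le_abse_integral _ _ _) _ => //.
    exact: measurable_int iD.
  apply: le_trans hoelder_D _.
  rewrite -/Y Yy poweR_EFin EFinM; apply: lee_wpmul2r; first by rewrite lee_fin powR_ge0.
  rewrite -poweR_EFin; apply: gt0_ler_poweR bound_D; first by rewrite invr_ge0 ltW.
    rewrite in_itv/= leey andbT; apply: integral_ge0 => x _.
    by rewrite lee_fin mulr_ge0 ?powR_ge0.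
  by rewrite in_itv/= leey andbT lee_fin mulr_ge0 ?powR_ge0.
rewrite (powRM _ (powR_ge0 _ p) a0) -powRrM mulfV ?gt_eqF// powRr1 ?mulr_ge0 ?(ltW dc0)//.
rewrite [C * _]mulrC -!mulrA ler_pM2l// => aC.
rewrite Aa Yy -EFinM lee_fin.
have [->|an0] := eqVneq a 0; first by rewrite mulr_ge0 ?powR_ge0.
have apos : 0 < a by rewrite lt_neqAle eq_sym an0.
(* Division by [a^(1/p)] leaves [a^(1/q)] on the left, as [1/p + 1/q = 1]. *)
have {}aC : a `^ q^-1 <= C * y `^ q^-1.
  rewrite -(ler_pM2l (powR_gt0 p^-1 apos)) -powRD ?pq ?oner_eq0// powRr1//.
  by rewrite mulrCA.
have rootK z : 0 <= z -> z = (z `^ q^-1) `^ q.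
  by move=> z0; rewrite -powRrM mulVf ?gt_eqF// powRr1.
rewrite (rootK _ a0) [X in _ <= _ * X](rootK _ y0) -powRM ?powR_ge0//.
by rewrite ge0_ler_powR ?nnegrE ?(ltW q0) ?powR_ge0// mulr_ge0 ?powR_ge0.
Qed.

End fixed_interval.

(** * Sign of the constant, removal of the cutoff, conclusion *)

(** The indicator of [[0, 1]] has positive norm in [L^p(v)], so a negative [C] would bound a
    nonnegative quantity by a negative one. *)
Lemma commutator_bounded_ge0 p b u v C : 1 < p -> weight v ->
  commutator_bounded p b u v C -> 0 <= C.
Proof.
move=> p1 [[mv _ _] v0 vpos] H.
pose J := (`[0, 1]%classic : set R).
have mJ : measurable (J : set (measurableTypeR R)) by exact: measurable_itv.
have hf : bounded_compactly_supported (\1_J : R -> R).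
  exact: (@bounded_compactly_supported_indic _ 0 1).
rewrite leNgt; apply/negP => C0; have := H _ hf; apply/negP; rewrite -ltNge.
apply: (@lt_le_trans _ _ 0%E); last exact: poweR_ge0.
apply: mule_lt0_gt0; first by rewrite lte_fin.
apply: poweR_gt0.
have -> : (\int[mu]_x (`|(EFin \o \1_J) x| `^ p * (v x)%:E))%E = wmeas v J.
  rewrite /wmeas [RHS]integral_mkcond; apply: eq_integral => x _ /=.
  rewrite indicE /patch; case: (x \in _); rewrite ?normr1 ?normr0 ?powR1 ?mul1e//.
  by rewrite powR0 ?mul0e// gt_eqF// (lt_trans ltr01).
rewrite lt_neqAle eq_sym; apply/andP; split; last first.
  by apply: integral_ge0 => x _; rewrite lee_fin.
apply/eqP => vJ.
have mvJ : measurable_fun J (EFin \o v).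
  exact/measurable_funTS/measurable_EFinP.
(* Were the mass zero, [v] would vanish almost everywhere on [[0, 1]], against [v > 0] almost
   everywhere and the positive measure of the interval. *)
have : (\int[mu]_(x in J) `|(EFin \o v) x| = 0)%E.
  by rewrite -vJ; apply: eq_integral => x _ /=; rewrite ger0_norm.
move/(ae_eq_integral_abs mu mJ mvJ) => v_ae0.
have : mu.-negligible J.
  have := @filterI _ _ (ae_filter_ringOfSetsType mu) _ _ vpos v_ae0.
  apply: negligibleS => x xJ /= [vx /(_ xJ)] [] v_0.
  by rewrite v_0 ltxx in vx.
move/(negligibleP _ mJ) => muJ0; have : mu J = 0%E := muJ0.
rewrite /J lebesgue_measure_itv/= lte_fin ltr01.
by rewrite -EFinB subr0 => /eqP; rewrite eqe oner_eq0.
Qed.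

(** Monotone convergence removes the cutoff from the truncated bound, whose constant does not depend
    on the cutoff level. *)
Lemma oscillation_dual_bound p b u v C (c d : R) I :
  1 < p -> 0 <= C -> locally_integrable [set: R] b ->
  weight u -> weight v -> commutator_bounded p b u v C ->
  c < d -> measurable I -> (forall x, I x -> x \in `[c, d]) ->
  mu I = (d - c)%:E ->
  (oscillation (conj_exp p) (fun x => v x `^ (- (conj_exp p / p)))%R
     (fun x => u x `^ (- (conj_exp p / p)))%R b I <= C%:E)%E.
Proof.
move=> p1 C0 lb wu wv bound cd mI Icd muI.
have [[mv _ _] v0 _] := wv.
have mb : measurable_fun [set: R] b by case: lb.
have p0 : 0 < p by exact: lt_trans p1.
have q0 : 0 < conj_exp p := lt_trans ltr01 (conj_exp_gt1 p1).
apply: oscillation_le => //; [by move=> x; exact: powR_ge0..|move=> Yoo].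
set Y := wmeas _ I in Yoo *.
pose w x := b x - avg b I.
have mw : measurable_fun [set: R] w by exact: measurable_funB.
pose F x := `|w x| `^ conj_exp p * v x `^ (- (conj_exp p / p)).
have F0 x : 0 <= F x by rewrite mulr_ge0 ?powR_ge0.
have mF : measurable_fun [set: R] F.
  apply: measurable_funM.
    by apply: (measurableT_comp (measurable_powR _)); exact: measurableT_comp.
  exact: (measurableT_comp (measurable_powR _)).
(* The level [N = n + 1] is positive from [n = 0] on, as the truncated bound requires. *)
pose E n := I `&` ((fun x => `|w x|) @^-1` `]-oo, n.+1%:R] `&` v @^-1` `[n.+1%:R^-1, +oo[).
have mE n : measurable (E n).
  apply: measurableI => //; apply: measurableI.
    rewrite -[X in measurable X]setTI.
    have mnw : measurable_fun [set: R] (fun x => `|w x|) by exact: measurableT_comp.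
    exact: mnw.
  by rewrite -[X in measurable X]setTI; exact: mv.
have EP n x : E n x <-> [/\ I x, `|w x| <= n.+1%:R & n.+1%:R^-1 <= v x].
  by rewrite /E /= !in_itv/= andbT; split => [[? []]|[]].
pose g n := (EFin \o F) \_ (E n).
have gI n : (\int[mu]_(x in I) g n x <= (C `^ conj_exp p)%:E * Y)%E.
  rewrite -integral_mkcondr (_ : I `&` E n = E n); last first.
    by rewrite /E setIA setIid.
  apply: (oscillation_dual_truncated p1 C0 lb wu wv bound cd mI Icd muI (N := n.+1%:R)) => //.
  - by move=> x /EP[].
  - by move=> x /EP[].
  - by move=> x /EP[].
have glim x : I x -> g n x @[n --> \oo] --> (F x)%:E.
  (* A point with [v x = 0] lies in no [E n], but there [F x = 0] because [0] to a nonzero power is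
     [0]; every other point of [I] eventually enters [E n]. *)
  move=> Ix; have [vx|vx] := ltP 0 (v x); last first.
    have Fx : F x = 0.
      rewrite /F (_ : v x = 0) ?powR0 ?mulr0//; last by apply: le_anti; rewrite vx v0.
      by rewrite oppr_eq0 gt_eqF// divr_gt0.
    apply: cvg_near_cst; apply: nearW => n; rewrite /g /patch /= Fx.
    by case: ifP.
  apply: cvg_near_cst; near=> n.
  rewrite /g /patch ifT// inE; apply/EP; split => //.
    have : `|w x| <= n%:R by near: n; exact: nbhs_infty_ger.
    by move=> /le_trans; apply; rewrite ler_nat.
  apply: ltW; near: n; exact: (@cvgr_lt _ _ _ _ _ _ (@cvg_harmonic R)).
have gmono x : I x -> {homo g^~ x : n m / (n <= m)%N >-> (n <= m)%E}.
  move=> Ix n m nm; rewrite /g /patch.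
  case: (boolP (x \in E n)) => [|_]; last first.
    by case: ifP => // _; rewrite lee_fin.
  rewrite inE => /EP[_ wn vn]; rewrite ifT// inE; apply/EP; split => //.
    by rewrite (le_trans wn)// ler_nat.
  by rewrite (le_trans _ vn)// lef_pV2 ?posrE// ler_nat.
have mg n : measurable_fun I (g n).
  apply: measurable_funTS; apply/(measurable_restrictT _ _).1; first exact: mE.
  exact/measurable_funTS/measurable_EFinP.
have g0 n x : I x -> (0 <= g n x)%E.
  by move=> _; apply: erestrict_ge0 => y _; rewrite lee_fin.
have mIR : measurable (I : set (measurableTypeR R)) := mI.
have cg := @cvg_monotone_convergence _ _ _ mu I mIR g mg g0 gmono.
have -> : (\int[mu]_(x in I) (F x)%:E = limn (fun n => \int[mu]_(x in I) g n x))%E.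
  rewrite -monotone_convergence//; apply: eq_integral => x; rewrite inE => Ix.
  by apply/esym/cvg_lim => //; exact: glim.
apply: lime_le; first exact: (cvgP _ cg).
by apply: nearW => n; exact: gI.
Unshelve. all: by end_near. Qed.

End commutator.

Theorem theorem1p8 (R : realType) (p : R) (b u v : R -> R) (C : R) :
  1 < p ->
  locally_integrable [set: R] b ->
  weight u -> weight v ->
  (forall f : R -> R, bounded_compactly_supported f ->
     (wnorm p u (hilbert_commutator b f) <= C%:E * wnorm p v (EFin \o f))%E) ->
  let p' := conj_exp p in
  let u' := fun x => u x `^ (- (p' / p)) in
  let v' := fun x => v x `^ (- (p' / p)) in
  (ereal_sup [set oscillation p u v b I | I in bounded_interval] <= C%:E)%E /\
  (ereal_sup [set oscillation p' v' u' b I | I in bounded_interval] <= C%:E)%E.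
Proof.
move=> p1 lb wu wv H p' u' v'.
have C0 : 0 <= C by exact: commutator_bounded_ge0 H.
split; apply: ge_ereal_sup => _ [I /bounded_interval_itv[c [d [cd mI Icd muI]]] <-].
  exact: oscillation_bound cd mI Icd muI.
exact: oscillation_dual_bound cd mI Icd muI.
Qed.
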